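(* Let $h\ge 3$ and let $m$ be a positive integer with $\omega=\omega(m)\ge 2$, and let $\varpi=\varpi(m)$. Then there are $\mathrm{CC}^h[m]$-circuits of size $2^{O(n^{1/((\omega-1)(h-2)+\varpi)}\log n)}$ computing the $n$-ary conjunction $\mathrm{AND}_n$.
   Context: For an integer $m\ge 1$ and $A\subseteq\{0,\dots,m-1\}$, a gate $\mathrm{MOD}_m^A$ takes finitely many Boolean inputs (counted with multiplicity, since a wire may be connected several times) and outputs $1$ if their sum modulo $m$ lies in $A$, and $0$ otherwise. A $\mathrm{CC}^h[m]$-circuit is a Boolean circuit of depth $h$ all of whose gates are of the form $\mathrm{MOD}_m^A$ (with $A$ possibly different for each gate), with Boolean variable inputs (constants allowed) and multiple wires allowed. The size of a circuit is its number of gates. $\omega(m)$ is the number of distinct prime divisors of $m$, and $\varpi(m)$ is the number of prime divisors $p$ of $m$ with $p\ge\omega(m)$. *)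

(* Defs.v *)
From mathcomp Require Import all_boot.
From Stdlib Require Import Reals.
Set Implicit Arguments. Unset Strict Implicit. Unset Printing Implicit Defensive.

(* A wire feeding a gate: an input variable x_i, a Boolean constant,
   or the output of an earlier gate (referenced by its position). *)
Inductive wire := WVar of nat | WConst of bool | WGate of nat.

(* A gate MOD_m^A: accepting set A ⊆ {0,...,m-1} and a list of input wires
   (a list, so that a wire may be connected several times). *)
Record gate (m : nat) := Gate { gA : {set 'I_m}; gin : seq wire }.

(* A circuit is a list of gates in topological order; the output is the
   last gate.  *)
Definition circuit (m : nat) := seq (gate m).

Definition wire_ok (n k : nat) (w : wire) : bool :=
  match w with WVar i => i < n | WConst _ => true | WGate j => j < k end.

Definition wf_circuit (m n : nat) (C : circuit m) : bool :=
  (0 < size C) &&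
  all (fun k => all (wire_ok n k) (gin (nth (Gate set0 [::]) C k))) (iota 0 (size C)).

Definition wire_val (x : nat -> bool) (vals : seq bool) (w : wire) : bool :=
  match w with WVar i => x i | WConst b => b | WGate j => nth false vals j end.

Definition gate_val (m : nat) (x : nat -> bool) (vals : seq bool) (g : gate m) : bool :=
  [exists a in gA g, nat_of_ord a == (sumn (map (fun w => nat_of_bool (wire_val x vals w)) (gin g))) %% m].

Fixpoint gate_vals_rec (m : nat) (x : nat -> bool) (done : seq bool) (gs : seq (gate m)) : seq bool :=
  match gs with
  | [::] => done
  | g :: gs' => gate_vals_rec x (rcons done (gate_val x done g)) gs'
  end.

Definition gate_vals (m : nat) (x : nat -> bool) (C : circuit m) := gate_vals_rec x [::] C.

Definition circuit_out (m : nat) (C : circuit m) (x : nat -> bool) : bool :=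
  last false (gate_vals x C).

Definition wire_depth (ds : seq nat) (w : wire) : nat :=
  match w with WGate j => nth 0 ds j | _ => 0 end.

Fixpoint gate_depths_rec (m : nat) (done : seq nat) (gs : seq (gate m)) : seq nat :=
  match gs with
  | [::] => done
  | g :: gs' => gate_depths_rec (rcons done (\max_(w <- gin g) wire_depth done w).+1) gs'
  end.

Definition circuit_depth (m : nat) (C : circuit m) : nat := last 0 (gate_depths_rec [::] C).

Definition circuit_size (m : nat) (C : circuit m) : nat := size C.

Definition CC_circuit (h m n : nat) (C : circuit m) : bool :=
  wf_circuit n C && (circuit_depth C == h).

Definition computes_AND (m n : nat) (C : circuit m) : Prop :=
  forall x : nat -> bool, circuit_out C x = [forall i : 'I_n, x i].

Definition omega (m : nat) : nat := size (primes m).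
Definition varpi (m : nat) : nat := count (fun p => omega m <= p) (primes m).

(* Main.v *)
Require Import Defs.
From Stdlib Require Import ZArith Reals Lra.
From HB Require Import structures.
From mathcomp Require Import all_boot zify.
Set Implicit Arguments. Unset Strict Implicit. Unset Printing Implicit Defensive.

(** The bound obtained has the larger denominator [(omega - 1)(h - 2) + omega].

    Cut the [n] variables into [d ^ omega] blocks and let [w] be the number of
    blocks whose conjunction is true.  For each prime [p] of [m] take [p ^ k]
    just above [d].  A [p ^ k]-periodic function of [w] is, modulo [p], a
    combination of the binomials ['C(w, j)], [j < p ^ k], and ['C(w, j)] is the
    sum of the conjunctions of [j] blocks.  So the test [w = d ^ omega], being
    a conjunction of congruences modulo the [p ^ k], is one [MOD_m] gate on top
    of [2 ^ O(d log d)] conjunctions of [O(d)] blocks each.  If depth [h]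
    handles [d ^ e] variables, blocks may have [d ^ (e - 1)] of them, and depth
    [h + 1] handles [d ^ (e + omega - 1)].  The recursion starts at depth [1]
    with [e = 1]: modulo [p], a conjunction of [d] variables is a combination
    of [2 ^ O(d)] [MOD_q] gates, for any prime [q] of [m] other than [p]. *)

(** * Values and depths of circuits under appending gates *)

Lemma wire_comparable : comparable wire.
Proof. by move=> v w; rewrite /decidable; repeat decide equality. Qed.

HB.instance Definition _ := hasDecEq.Build wire (compareP wire_comparable).

Definition gates_ok (m n : nat) (C : circuit m) : bool :=
  all (fun k => all (wire_ok n k) (gin (nth (Gate set0 [::]) C k)))
    (iota 0 (size C)).

Definition gate_depths (m : nat) (C : circuit m) := gate_depths_rec [::] C.

Definition wires_sum (x : nat -> bool) (vals : seq bool) (ws : seq wire) : nat :=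
  sumn [seq nat_of_bool (wire_val x vals w) | w <- ws].

Lemma gate_vals_rec_cat (m : nat) x done (C D : circuit m) :
  gate_vals_rec x done (C ++ D) = gate_vals_rec x (gate_vals_rec x done C) D.
Proof. by elim: C done => //= g C IH done; rewrite IH. Qed.

Lemma gate_depths_rec_cat (m : nat) done (C D : circuit m) :
  gate_depths_rec done (C ++ D) = gate_depths_rec (gate_depths_rec done C) D.
Proof. by elim: C done => //= g C IH done; rewrite IH. Qed.

Lemma gate_vals_rcons (m : nat) x (C : circuit m) g :
  gate_vals x (rcons C g) = rcons (gate_vals x C) (gate_val x (gate_vals x C) g).
Proof. by rewrite /gate_vals -cats1 gate_vals_rec_cat. Qed.

Lemma gate_depths_rcons (m : nat) (C : circuit m) g :
  gate_depths (rcons C g) =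
  rcons (gate_depths C) (\max_(w <- gin g) wire_depth (gate_depths C) w).+1.
Proof. by rewrite /gate_depths -cats1 gate_depths_rec_cat. Qed.

Lemma size_gate_vals (m : nat) x (C : circuit m) :
  size (gate_vals x C) = size C.
Proof.
by elim/last_ind: C => // C g IH; rewrite gate_vals_rcons !size_rcons IH.
Qed.

Lemma size_gate_depths (m : nat) (C : circuit m) : size (gate_depths C) = size C.
Proof.
by elim/last_ind: C => // C g IH; rewrite gate_depths_rcons !size_rcons IH.
Qed.

Lemma gate_vals_cat (m : nat) x (C D : circuit m) :
  exists t, gate_vals x (C ++ D) = gate_vals x C ++ t.
Proof.
elim/last_ind: D => [|D g [t IH]]; first by exists [::]; rewrite !cats0.
by rewrite -rcons_cat gate_vals_rcons IH rcons_cat; eexists.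
Qed.

Lemma gate_depths_cat (m : nat) (C D : circuit m) :
  exists t, gate_depths (C ++ D) = gate_depths C ++ t.
Proof.
elim/last_ind: D => [|D g [t IH]]; first by exists [::]; rewrite !cats0.
by rewrite -rcons_cat gate_depths_rcons IH rcons_cat; eexists.
Qed.

Lemma gates_ok_rcons (m n : nat) (C : circuit m) g :
  gates_ok n (rcons C g) = gates_ok n C && all (wire_ok n (size C)) (gin g).
Proof.
rewrite /gates_ok size_rcons -addn1 iotaD all_cat /= add0n andbT.
rewrite nth_rcons ltnn eqxx; congr (_ && _).
by apply: eq_in_all => k; rewrite mem_iota nth_rcons => /andP[_ ->].
Qed.

Lemma wire_ok_leq n k l w : k <= l -> wire_ok n k w -> wire_ok n l w.
Proof. by move=> kl; case: w => //= j jk; apply: leq_trans kl. Qed.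

Lemma wire_val_cat n x v t w :
  wire_ok n (size v) w -> wire_val x (v ++ t) w = wire_val x v w.
Proof. by case: w => //= j jv; rewrite nth_cat jv. Qed.

Lemma wire_depth_cat n ds t w :
  wire_ok n (size ds) w -> wire_depth (ds ++ t) w = wire_depth ds w.
Proof. by case: w => //= j jv; rewrite nth_cat jv. Qed.

Lemma wires_sum_cat n x v t ws :
  all (wire_ok n (size v)) ws -> wires_sum x (v ++ t) ws = wires_sum x v ws.
Proof.
rewrite /wires_sum; elim: ws => //= w ws IH /andP[okw /IH ->].
by rewrite (wire_val_cat _ _ okw).
Qed.

Lemma gate_valE m (mpos : 0 < m) (A : pred nat) x vals ws :
  gate_val x vals (Gate [set a : 'I_m | A a] ws) = A (wires_sum x vals ws %% m).
Proof.
rewrite /gate_val /= -/(wires_sum x vals ws); apply/existsP/idP.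
  by case=> a /andP[]; rewrite inE => Aa /eqP <-.
move=> As; exists (Ordinal (ltn_pmod (wires_sum x vals ws) mpos)).
by rewrite inE As /=.
Qed.

(** * Sums of wires modulo [m] and their closure properties *)

Section Bundles.
Variables (m n : nat).
Hypothesis mpos : 0 < m.
Implicit Types (C D : circuit m) (g : (nat -> bool) -> nat).

(* Quantifying over the circuit [C] to be extended lets bundles be stacked
   without renumbering gates. *)
Definition bundle (h s : nat) g : Prop :=
  forall C, gates_ok n C -> exists (D : circuit m) (ws : seq wire),
    [/\ gates_ok n (C ++ D), size D <= s,
        all (wire_ok n (size (C ++ D))) ws,
        all (fun w => wire_depth (gate_depths (C ++ D)) w <= h) ws
      & forall x, wires_sum x (gate_vals x (C ++ D)) ws = g x %[mod m]].

Lemma bundle_var i : i < n -> bundle 0 0 (fun x => x i).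
Proof.
move=> lin C okC; exists [::], [:: WVar i]; rewrite cats0 /= lin.
by split=> // x; rewrite /wires_sum /= addn0.
Qed.

Lemma bundle_leq h h' s s' g :
  h <= h' -> s <= s' -> bundle h s g -> bundle h' s' g.
Proof.
move=> hh' ss' B C /B [D [ws [ok sz wok dep sum]]]; exists D, ws; split=> //.
  exact: leq_trans ss'.
by apply: sub_all dep => w /leq_trans; apply.
Qed.

Lemma bundle_eqmod h s g g' :
  (forall x, g x = g' x %[mod m]) -> bundle h s g -> bundle h s g'.
Proof.
move=> eqg B C /B [D [ws [ok sz wok dep sum]]]; exists D, ws.
by split=> // x; rewrite sum.
Qed.

Lemma bundle0 h : bundle h 0 (fun _ => 0).
Proof. by move=> C okC; exists [::], [::]; rewrite cats0. Qed.

Lemma bundle_add h s s' g g' :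
  bundle h s g -> bundle h s' g' -> bundle h (s + s') (fun x => g x + g' x).
Proof.
move=> B B' C /B [D [ws [ok sz wok dep sum]]].
have /B' [D' [ws' [ok' sz' wok' dep' sum']]] := ok.
exists (D ++ D'), (ws ++ ws'); rewrite catA size_cat leq_add //.
have wokD : all (wire_ok n (size ((C ++ D) ++ D'))) ws.
  by apply: sub_all wok => w; apply: wire_ok_leq; rewrite [leqRHS]size_cat leq_addr.
split=> //.
- by rewrite all_cat wokD.
- rewrite all_cat dep' andbT; apply/allP => w wws.
  have [t ->] := gate_depths_cat (C ++ D) D'.
  rewrite (@wire_depth_cat n) ?size_gate_depths; last exact: (allP wok).
  exact: (allP dep).
- move=> x; rewrite /wires_sum map_cat sumn_cat.
  rewrite -!/(wires_sum _ _ _) -modnDm sum'.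
  have [t ->] := gate_vals_cat x (C ++ D) D'.
  by rewrite (@wires_sum_cat n) ?size_gate_vals // sum modnDm.
Qed.

(** Multiple wires make coefficients free: every wire is repeated [c] times and no gate is added. *)
Lemma bundle_scale h s g c : bundle h s g -> bundle h s (fun x => c * g x).
Proof.
move=> B C /B [D [ws [ok sz wok dep sum]]].
exists D, (flatten (nseq c ws)); split=> //.
- by apply/allP => w /flattenP[u /nseqP[-> _]]; apply: (allP wok).
- by apply/allP => w /flattenP[u /nseqP[-> _]]; apply: (allP dep).
move=> x; rewrite -modnMmr -sum modnMmr; congr (_ %% _).
elim: c => //= c IH.
by rewrite /wires_sum map_cat sumn_cat -!/(wires_sum _ _ _) IH mulSn.
Qed.

Lemma bundle_const h c : bundle h 0 (fun _ => c).
Proof.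
apply: (bundle_eqmod (g := fun _ => c * 1)) => [x|]; first by rewrite muln1.
apply: bundle_scale => C okC.
by exists [::], [:: WConst true]; rewrite cats0; split.
Qed.

Lemma bundle_sum h s (I : eqType) (r : seq I) (P : pred I) (G : I -> (nat -> bool) -> nat) :
  (forall i, i \in r -> P i -> bundle h s (G i)) ->
  bundle h (count P r * s) (fun x => \sum_(i <- r | P i) G i x).
Proof.
elim: r => [|i r IH] BG.
  by apply: (bundle_eqmod (g := fun=> 0)) (bundle0 _) => x; rewrite big_nil.
have {}IH : bundle h (count P r * s) (fun x => \sum_(i <- r | P i) G i x).
  by apply: IH => j jr; apply: BG; rewrite inE jr orbT.
have [Pi|nPi] := boolP (P i).
  apply: (bundle_eqmod (g := fun x => G i x + \sum_(i <- r | P i) G i x)).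
    by move=> x; rewrite big_cons Pi.
  by rewrite /= Pi mulnDl mul1n; apply: bundle_add IH; apply: BG; rewrite ?mem_head.
apply: (bundle_eqmod (g := fun x => \sum_(i <- r | P i) G i x)).
  by move=> x; rewrite big_cons (negbTE nPi).
by rewrite /= (negbTE nPi).
Qed.

Lemma bundle_gate h s g (A : pred nat) :
  bundle h s g -> bundle h.+1 s.+1 (fun x => A (g x %% m)).
Proof.
move=> B C /B [D [ws [ok sz wok dep sum]]].
exists (rcons D (Gate [set a : 'I_m | A a] ws)), [:: WGate (size (C ++ D))].
rewrite -rcons_cat gates_ok_rcons ok wok !size_rcons /= leqnn.
rewrite gate_depths_rcons nth_rcons size_gate_depths ltnn eqxx /= ltnS.
rewrite andbT; split=> //.
  by apply/bigmax_leqP_seq => w wws _; apply: (allP dep).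
move=> x; rewrite /wires_sum /= addn0 gate_vals_rcons nth_rcons size_gate_vals.
by rewrite ltnn eqxx gate_valE // sum.
Qed.

(* A chain of dummy gates, wired [m] times into the output gate, makes the
   depth exactly [h.+2]. *)
Lemma bundle_circuit h s g (A : pred nat) : bundle h.+1 s g ->
  exists C : circuit m,
    [/\ CC_circuit h.+2 n C, size C <= h.+2 + s
      & forall x, circuit_out C x = A (g x %% m)].
Proof.
move=> B.
pose ch k := mkseq (fun i => Gate (set0 : {set 'I_m}) (if i is j.+1 then [:: WGate j] else [::])) k.
have chS k : ch k.+1 = rcons (ch k) (Gate set0 (if k is j.+1 then [:: WGate j] else [::])).
  by rewrite /ch /mkseq -addn1 iotaD map_cat cats1.
have szch k : size (ch k) = k by rewrite size_mkseq.
have chok k : gates_ok n (ch k).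
  elim: k => // k IH; rewrite chS gates_ok_rcons IH szch /=.
  by case: k {IH} => //= j; rewrite ltnSn.
have chd k : nth 0 (gate_depths (ch k.+1)) k = k.+1.
  elim: k => [|k IH].
    by rewrite chS gate_depths_rcons nth_rcons size_gate_depths szch /= big_nil.
  rewrite chS gate_depths_rcons nth_rcons size_gate_depths szch ltnn eqxx /=.
  by rewrite big_seq1 /= IH.
move: (ch h.+1) (chok h.+1) (szch h.+1) (chd h) => C okC szC dC.
have [D [ws [ok sz wok dep sum]]] := B _ okC.
pose u := ws ++ nseq m (WGate h).
exists (rcons (C ++ D) (Gate [set a : 'I_m | A a] u)).
have hok : h < size (C ++ D) by rewrite size_cat szC leq_addr.
have dh : nth 0 (gate_depths (C ++ D)) h = h.+1.
  have [t ->] := gate_depths_cat C D.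
  by rewrite nth_cat size_gate_depths szC ltnSn dC.
split.
- rewrite /CC_circuit /wf_circuit -/(gates_ok _ _) gates_ok_rcons ok size_rcons /=.
  rewrite all_cat wok /= all_nseq /= hok orbT /=.
  rewrite /circuit_depth -/(gate_depths _) gate_depths_rcons last_rcons eqSS /=.
  rewrite /u big_cat /= eqn_leq; apply/andP; split.
    rewrite geq_max; apply/andP; split.
      by apply/bigmax_leqP_seq => w wws _; apply: (allP dep).
    by apply/bigmax_leqP_seq => w /nseqP[-> _] _; rewrite /= dh.
  apply: leq_trans (leq_maxr _ _); rewrite -{1}dh.
  apply: (@leq_bigmax_seq _ _ _ (wire_depth (gate_depths (C ++ D))) (WGate h)) => //.
  by apply/nseqP.
- by rewrite size_rcons size_cat szC -addnS -addSnnS leq_add2l.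
- move=> x; rewrite /circuit_out gate_vals_rcons last_rcons gate_valE //.
  rewrite /wires_sum map_cat sumn_cat map_nseq sumn_nseq -modnDmr modnMl addn0.
  by rewrite -/(wires_sum _ _ _) sum.
Qed.

End Bundles.

(** * Binomial coefficients modulo a prime *)

Lemma prime_dvd_bin_pfactor p k t :
  prime p -> 0 < t < p ^ k -> p %| 'C(p ^ k, t).
Proof.
move=> p_pr /andP[]; case: t => // t _ ltk; apply/negPn/negP.
rewrite -prime_coprime // => /(coprimeXl k) cop.
(* This identity relates [t.+1 * 'C(p ^ k, t.+1)] to a multiple of [p ^ k]; by coprimality [p ^ k]
   would divide the smaller number [t.+1]. *)
have := mul_bin_diag (p ^ k) t.
move/(congr1 (dvdn (p ^ k))); rewrite dvdn_mulr // Gauss_dvdl //.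
by move/esym/dvdn_leq => /(_ isT); rewrite leqNgt ltk.
Qed.

(** In Vandermonde's sum every term but the first has a factor ['C(p ^ k, i)] with
    [0 < i < p ^ k]. *)
Lemma bin_period p k j w :
  prime p -> j < p ^ k -> 'C(w + p ^ k, j) = 'C(w, j) %[mod p].
Proof.
move=> p_pr jk; rewrite addnC -Vandermonde big_ord_recl bin0 mul1n subn0.
rewrite -[X in _ = X %[mod _]]addn0; apply/eqP; rewrite eqn_modDl mod0n.
apply: dvdn_sum => i _.
rewrite dvdn_mulr // prime_dvd_bin_pfactor //= /bump leq0n add1n.
by apply: leq_ltn_trans jk.
Qed.

(** Newton's forward interpolation: ['C(w, j)] is 0 for [w < j] and 1 for [w = j], so the
    coefficients are found one at a time. Having [0 < p] inside the sigma type lets coefficients be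
    chosen for all [p] at once. *)
Lemma newton_interpolation_mod p (f : nat -> nat) N :
  {c : nat -> nat | 0 < p -> forall w, w < N ->
     \sum_(j < N) c j * 'C(w, j) = f w %[mod p]}.
Proof.
elim: N => [|N [c Hc]]; first by exists (fun=> 0).
pose S := \sum_(j < N) c j * 'C(N, j).
(* [p.-1 * S] serves as [- S] modulo [p]. *)
exists (fun j => if j == N then f N + p.-1 * S else c j) => p0 w.
rewrite ltnS leq_eqVlt big_ord_recr /= eqxx.
have -> : \sum_(i < N) (if i == N :> nat then f N + p.-1 * S else c i) * 'C(w, i)
          = \sum_(i < N) c i * 'C(w, i).
  by apply: eq_bigr => i _; rewrite (ltn_eqF (ltn_ord i)).
case/orP => [/eqP ->|wN]; last by rewrite bin_small // muln0 addn0 Hc.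
rewrite binn muln1 -/S addnCA -mulSn prednK //.
by rewrite -modnDmr modnMr addn0.
Qed.

Lemma bin_sum_period p k (c : nat -> nat) w : prime p ->
  \sum_(j < p ^ k) c j * 'C(w, j) = \sum_(j < p ^ k) c j * 'C(w %% p ^ k, j) %[mod p].
Proof.
move=> p_pr; rewrite {1}(divn_eq w (p ^ k)).
elim: (w %/ _) => [|t IH]; first by rewrite mul0n.
rewrite -IH mulSn -addnA (addnC (p ^ k)).
elim/big_ind2: _ => // [a a' b b' E E'|j _]; first by rewrite -modnDm E E' modnDm.
by rewrite -modnMmr bin_period // modnMmr.
Qed.

Lemma bin_leq_exp a j : 'C(a, j) <= a.+1 ^ j.
Proof.
elim: a j => [|a IH] [|j] //.
rewrite binS; apply: leq_trans (leq_add (IH _) (IH _)) _.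
rewrite [in leqRHS]expnS expnS -mulSnr leq_mul2l; apply/orP; right.
by case: (posnP j) => [->|j0] //; rewrite leq_exp2r.
Qed.

(** * Congruences modulo the primes of [m] as one divisibility by [m] *)

Lemma eqmod_scale m p X Y : p %| m -> X = Y %[mod p] ->
  m %/ p * X = m %/ p * Y %[mod m].
Proof. by move=> pm E; rewrite -{2 4}(divnK pm) -!muln_modr E. Qed.

Lemma dvdn_divn_mul m p g : 0 < m -> p %| m -> (m %| m %/ p * g) = (p %| g).
Proof.
move=> m0 pm; rewrite -{1}(divnK pm) dvdn_pmul2l // divn_gt0; last exact: dvdn_gt0 pm.
exact: dvdn_leq.
Qed.

(** For a prime [q != p] of [m], the full power of [p] in [m] divides [m %/ q], whereas [m %/ p]
    lacks exactly one factor [p]; modulo that power only the term of [p] remains. *)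
Lemma dvdn_sum_primes m (g : nat -> nat) : 0 < m ->
  (m %| \sum_(p <- primes m) m %/ p * g p) = all (fun p => p %| g p) (primes m).
Proof.
move=> m0; apply/idP/allP => [dv p pm|H]; last first.
  rewrite big_seq; apply: dvdn_sum => p pm; rewrite dvdn_divn_mul ?H //.
  by move: pm; rewrite mem_primes => /and3P[].
have := pm; rewrite mem_primes => /and3P[p_pr _ pdm].
have := dvdn_trans (pfactor_dvdnn p m) dv.
rewrite (bigD1_seq p) ?primes_uniq //= dvdn_addl; last first.
  rewrite big_seq_cond; apply: dvdn_sum => q /andP[qm qp]; apply: dvdn_mulr.
  move: qm; rewrite mem_primes => /and3P[q_pr _ qdm].
  rewrite -(@Gauss_dvdl _ _ q) ?divnK ?pfactor_dvdnn //.
  by rewrite coprimeXl // prime_coprime // dvdn_prime2 // eq_sym.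
have [r cop Em] := pfactor_coprime p_pr m0.
have : 0 < logn p m by rewrite logn_gt0.
case: (logn p m) Em => // k -> _.
rewrite expnSr mulnA mulnK ?prime_gt0 // mulnAC mulnC dvdn_pmul2r ?expn_gt0 ?prime_gt0 //.
by rewrite Gauss_dvdr.
Qed.

Lemma dvdn_prod_pfactors (r : seq nat) (k : nat -> nat) N :
  uniq r -> all prime r -> all (fun p => p ^ k p %| N) r ->
  \prod_(p <- r) p ^ k p %| N.
Proof.
elim: r => [|p r IH] /=; first by rewrite big_nil dvd1n.
move=> /andP[pr ur] /andP[p_pr r_pr] /andP[dp dr]; rewrite big_cons Gauss_dvd ?dp ?IH //.
rewrite coprime_sym big_seq; elim/big_ind: _ => [|a b ca cb|q qr].
- exact: coprime1n.
- by rewrite coprimeMl ca.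
rewrite coprimeXl // coprimeXr // prime_coprime ?(allP r_pr q) // dvdn_prime2 ?(allP r_pr q) //.
by apply: contraNneq pr => <-.
Qed.

Lemma sum_dvdn_shift q g : 0 < q -> \sum_(t < q) (q %| g + t) = 1.
Proof.
move=> q0; pose t0 := Ordinal (ltn_pmod (q - g %% q) q0).
have d0 : q %| g + t0.
  by rewrite /dvdn /= modnDmr -modnDml subnKC ?modnn // ltnW // ltn_pmod.
rewrite (bigD1 t0) //= d0 big1 // => t tt0; apply/eqP; rewrite eqb0.
apply: contra tt0 => dt; apply/eqP/val_inj.
have : g + t == g + t0 %[mod q] by rewrite (eqP dt) (eqP d0).
by rewrite eqn_modDl !modn_small ?ltn_ord // => /eqP.
Qed.

Lemma all_flatten_map (T U : Type) (a : pred U) (f : T -> seq U) s :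
  all a (flatten (map f s)) = all (fun i => all a (f i)) s.
Proof. by elim: s => //= i s IH; rewrite all_cat IH. Qed.

(** * Conjunctions as bundles *)

Section AndBundles.
Variables (m n : nat).
Hypothesis mpos : 0 < m.

(* Since [q] is invertible modulo [p], the induction on [xs] is driven by
   [q * (q %| g) * y = \sum_(t < q) (q %| g + t * (1 + (q - 1) * y)) + y - 1]. *)
Lemma bundle_dvd_all p q xs g :
  p \in primes m -> q \in primes m -> p != q ->
  all (fun i => i < n) xs -> bundle m n 0 0 g ->
  bundle m n 1 ((q + 2) ^ size xs) (fun x => m %/ p * ((q %| g x) && all x xs)).
Proof.
rewrite !mem_primes => /and3P[p_pr _ pm] /and3P[q_pr _ qm] pq.
elim: xs g => [|y xs IH] g /= okxs Bg.
  (* With no variables left, one gate tests [q %| g x] in the form [m %| m %/ q * g x]. *)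
  apply: (bundle_eqmod (g := fun x => m %/ p * ((m %/ q * g x) %% m == 0))).
    by move=> x; rewrite andbT -[_ %% m == 0]/(m %| _) dvdn_divn_mul.
  apply: bundle_scale.
  exact: (bundle_gate mpos (fun v => v == 0) (bundle_scale (m %/ q) Bg)).
have /andP[yn {}okxs] := okxs.
have [u uq] : exists u, u * q = 1 %[mod p].
  have /(coprimeP _ (prime_gt0 q_pr)) [[u v] /= E] : coprime q p.
    by rewrite prime_coprime // dvdn_prime2 // eq_sym.
  exists u; rewrite (_ : u * q = 1 + v * p); last by lia.
  by rewrite addnC modnMDl.
(* [l x] is [q] if [x y] holds and 1 otherwise: the shifts by [t * l x] then either all preserve
   divisibility by [q] or run through all residues. *)
pose l (x : nat -> bool) := 1 + q.-1 * (x y : nat).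
have Bl : bundle m n 0 0 l.
  exact: (bundle_add (@bundle_const m n 0 1) (bundle_scale q.-1 (@bundle_var m n y yn))).
pose G t (x : nat -> bool) := m %/ p * ((q %| g x + t * l x) && all x xs).
(* [u] inverts [q] modulo [p], and [m.-1] serves as [-1] modulo [m]. *)
apply: (bundle_eqmod (g := fun x => u * (\sum_(t <- index_iota 0 q) G t x
   + (m %/ p * ((q %| l x) && all x xs) + m.-1 * (m %/ p * ((q %| 0) && all x xs)))))).
  move=> x; rewrite /G -big_distrr /= mulnCA -!mulnDr mulnCA.
  apply: eqmod_scale => //; rewrite big_mkord /l.
  case: (all x xs); last first.
    by rewrite !andbF muln0 big1 ?muln0 // => t _; rewrite andbF.
  rewrite !andbT dvdn0 muln1; case: (x y) => /=.
    rewrite muln1 add1n prednK ?prime_gt0 // dvdnn add1n prednK // andbT.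
    rewrite (eq_bigr (fun _ => (q %| g x) : nat)); last first.
      by move=> t _; rewrite andbT dvdn_addl // dvdn_mull.
    rewrite sum_nat_const card_ord mulnDr mulnA -modnDmr.
    by rewrite (eqP (dvdn_mull u pm)) addn0 -modnMml uq modnMml mul1n.
  rewrite muln0 addn0 dvdn1 andbF.
  rewrite (eq_bigr (fun t : 'I_q => (q %| g x + t) : nat)); last first.
    by move=> t _; rewrite muln1 andbT.
  rewrite sum_dvdn_shift ?prime_gt0 //.
  have -> : (q == 1) = false by apply/negbTE; rewrite neq_ltn prime_gt1 ?orbT.
  by rewrite add0n add1n prednK // (eqP (dvdn_mull u pm)) mod0n.
apply: bundle_scale.
(* There are [q] recursive calls for the shifts and two for the corrections [y] and [- 1]. *)
have -> : (q + 2) ^ (size xs).+1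
  = q * (q + 2) ^ size xs + ((q + 2) ^ size xs + (q + 2) ^ size xs).
  by rewrite expnS mulnDl mul2n addnn.
apply: bundle_add; last apply: bundle_add.
- rewrite -[q in q * _](size_iota 0) -count_predT -[q in iota 0 q]subn0.
  apply: bundle_sum => t _ _; apply: IH => //.
  exact: (bundle_add Bg (bundle_scale t Bl)).
- exact: IH.
- exact: (bundle_scale _ (IH _ okxs (@bundle_const m n 0 0))).
Qed.

Lemma bundle_all p q xs :
  p \in primes m -> q \in primes m -> p != q -> all (fun i => i < n) xs ->
  bundle m n 1 ((q + 2) ^ size xs) (fun x => m %/ p * all x xs).
Proof.
move=> pm qm pq okxs.
have := bundle_dvd_all pm qm pq okxs (@bundle_const m n 0 0).
by apply: bundle_eqmod => x; rewrite dvdn0.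
Qed.

(** Here [a] is the number of blocks, [b] their length and [D] a bound on the degrees: joining
    [j <= D] blocks involves at most [D * b <= L] variables, within reach of the first
    hypothesis. *)
Lemma bundle_all_blocks h s L D a b xs (k : nat -> nat) :
  (forall p ys, p \in primes m -> all (fun i => i < n) ys -> size ys <= L ->
     bundle m n h s (fun x => m %/ p * all x ys)) ->
  a < \prod_(p <- primes m) p ^ k p ->
  (forall p, p \in primes m -> p ^ k p <= D) -> D * b <= L ->
  size xs <= a * b -> all (fun i => i < n) xs ->
  exists g, (forall x, (m %| g x) = all x xs) /\
    bundle m n h (size (primes m) * (D * (a.+1 ^ D * s))) g.
Proof.
move=> Bys aP kD DL sxs okxs.
(* The last blocks may be short or empty; an empty block counts as true, so the target count is
   always [a]. *)
pose bl (i : 'I_a) := take b (drop (i * b) xs).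
pose w (x : nat -> bool) := #|[set i | all x (bl i)]|.
have w_leq x : w x <= a by rewrite -[leqRHS](card_ord a) max_card.
have w_all x : all x xs = (w x == a).
  have -> : (w x == a) = [forall i, all x (bl i)].
    apply/eqP/forallP => [E i|H].
      have /eqP/setP/(_ i) : [set i | all x (bl i)] == setT.
        by rewrite eqEcard subsetT cardsT card_ord -[#|[set _ | _]|]/(w x) E /=.
      by rewrite !inE.
    have /setP ET : [set i | all x (bl i)] =i setT by move=> i; rewrite !inE H.
    by rewrite /w ET cardsT card_ord.
  apply/idP/forallP => [/allP H i|H].
    by apply/allP => y /mem_take/mem_drop/H.
  apply/(all_nthP 0) => t ts.
  have tab : t %/ b < a by rewrite ltn_divLR; lia.
  have /(all_nthP 0)/(_ (t %% b)) := H (Ordinal tab).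
  have tb : t %% b < b by rewrite ltn_pmod; lia.
  rewrite size_take_min leq_min tb size_drop /= nth_take // nth_drop -divn_eq.
  by apply; rewrite ltn_subRL -divn_eq.
(* The interpolated function is 0 at the residue of [a] and 1 at the others, so divisibility of
   [P p x] by [p] detects that [w x] is congruent to [a]. *)
pose c p := sval (newton_interpolation_mod p (fun r => r != a %% p ^ k p) (p ^ k p)).
pose P p x := \sum_(j < p ^ k p) c p j * 'C(w x, j).
have P_dvd p x : p \in primes m -> (p %| P p x) = (w x == a %[mod p ^ k p]).
  rewrite mem_primes => /and3P[p_pr _ _].
  have := svalP (newton_interpolation_mod p (fun r => r != a %% p ^ k p) (p ^ k p)).
  move=> /(_ (prime_gt0 p_pr) (w x %% p ^ k p)).
  rewrite ltn_pmod ?expn_gt0 ?prime_gt0 // => /(_ isT) E.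
  rewrite /dvdn /P bin_sum_period // E -/(dvdn _ _).
  by case: eqP; rewrite /= ?dvdn0 // dvdn1; case: eqP p_pr => // ->.
exists (fun x => \sum_(p <- primes m) m %/ p * P p x); split.
  move=> x; rewrite dvdn_sum_primes // w_all.
  (* Under all the congruences, [a - w x] is divisible by the product of the prime powers yet is at
     most [a], hence zero. *)
  rewrite (eq_in_all (a2 := fun p => p ^ k p %| a - w x)); last first.
    by move=> p pm; rewrite P_dvd // eq_sym eqn_mod_dvd.
  apply/idP/eqP => [dv|->]; last by rewrite subnn; apply/allP.
  apply/eqP; rewrite eqn_leq w_leq /= -subn_eq0; apply: contraTT aP => ne.
  rewrite -leqNgt; apply: leq_trans (leq_subr (w x) a).
  apply: dvdn_leq; first by rewrite lt0n.
  apply: dvdn_prod_pfactors => //; first exact: primes_uniq.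
  by apply/allP => p; rewrite mem_primes => /and3P[].
rewrite -count_predT; apply: bundle_sum => p pm _.
pose ys (S : {set 'I_a}) := flatten [seq bl i | i <- enum S].
have all_ys S x : all x (ys S) = (S \subset [set i | all x (bl i)]).
  rewrite all_flatten_map; apply/allP/subsetP => H i iS; have := H i.
    by rewrite mem_enum inE; apply.
  by rewrite -mem_enum inE => /(_ iS).
(* ['C(w x, j)] counts the [j]-sets of blocks contained in the set of true blocks. *)
apply: (bundle_eqmod (g := fun x => \sum_(j <- index_iota 0 (p ^ k p))
   \sum_(S <- enum {set 'I_a} | #|S| == j) c p j * (m %/ p * all x (ys S)))).
  move=> x; rewrite /P; congr (_ %% _).
  rewrite big_mkord big_distrr /=.
  apply: eq_bigr => j _; rewrite -big_distrr -big_distrr /= mulnCA; congr (_ * (_ * _)).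
  rewrite /w -cards_draws -sum1dep_card big_enum_cond /= [in RHS]big_mkcond.
  rewrite [in LHS]big_mkcond; apply: eq_bigr => S _ /=.
  by rewrite all_ys; case: (_ == _); case: (_ \subset _).
apply: (@bundle_leq _ _ h h (count predT (index_iota 0 (p ^ k p)) * (a.+1 ^ D * s))) => //.
  by rewrite leq_mul2r count_predT size_iota subn0 kD ?orbT.
apply: bundle_sum => j; rewrite mem_index_iota => /andP[_ jp] _.
have jD : j <= D by apply: leq_trans (ltnW jp) (kD _ pm).
apply: (@bundle_leq _ _ h h (count (fun S : {set 'I_a} => #|S| == j) (enum {set 'I_a}) * s)) => //.
  rewrite leq_mul2r; apply/orP; right.
  rewrite -sum1_count big_enum_cond /= sum1dep_card card_draws card_ord.
  exact: leq_trans (bin_leq_exp a j) (leq_pexp2l _ jD).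
apply: bundle_sum => S _ /eqP cS; apply: bundle_scale; apply: Bys => //.
  rewrite all_flatten_map; apply/allP => i _ /=.
  by apply/allP => y /mem_take/mem_drop/(allP okxs).
apply: leq_trans DL; rewrite size_flatten /shape -map_comp sumnE big_map.
rewrite big_enum /=; apply: leq_trans (_ : \sum_(i in S) b <= _).
  by apply: leq_sum => i _; rewrite /= size_take_min geq_minl.
by rewrite sum_nat_const cS leq_mul2r jD orbT.
Qed.
End AndBundles.

(** * Recursion on the depth *)

Lemma leq_exp2r_wk a b e : a <= b -> a ^ e <= b ^ e.
Proof. by case: e => // e ab; rewrite leq_exp2r. Qed.

Section Growth.
Variable m : nat.
Hypothesis mpos : 0 < m.
Hypothesis m_omega : 2 <= omega m.
Local Notation om := (omega m).

(** The base [d.+1] is at least 2 when [0 < d], so constant factors can be absorbed into [K] even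
    for [d = 1]. *)
Definition all_bundles h e := exists K, forall n d p xs,
  0 < d -> p \in primes m -> all (fun i => i < n) xs -> size xs <= d ^ e ->
  bundle m n h (d.+1 ^ (K * d)) (fun x => m %/ p * all x xs).

(** The gate testing [m %| g x] is left out, so [h] counts only the layers below it. *)
Definition all_gates h e := exists K, forall n d xs,
  0 < d -> all (fun i => i < n) xs -> size xs <= d ^ e ->
  exists g, (forall x, (m %| g x) = all x xs) /\ bundle m n h (d.+1 ^ (K * d)) g.

Lemma all_bundles1 : all_bundles 1 1.
Proof.
(* This [K] comes from [q + 2 <= m + 2 <= 2 ^ (m + 2)], for a second prime [q] of [m]. *)
exists (m + 2) => n d p xs d0 pm okxs; rewrite expn1 => sz.
have [q qm pq] : exists2 q, q \in primes m & p != q.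
  have := primes_uniq m; move: m_omega; rewrite /omega.
  case: (primes m) => [|q [|r s]] //= _; rewrite inE negb_or => /andP[/andP[qr _] _].
  have [->|pq] := eqVneq p q; first by exists r; rewrite ?inE ?eqxx ?orbT.
  by exists q; rewrite ?inE ?eqxx.
apply: bundle_leq (bundle_all mpos pm qm pq okxs) => //.
rewrite expnM; apply: leq_trans (leq_exp2r_wk _ _) (leq_pexp2l _ sz).
  have qlm : q <= m by move: qm; rewrite mem_primes => /and3P[_ _ /dvdn_leq]; apply.
  apply: leq_trans (leq_exp2r_wk _ (d0 : 1 < d.+1)).
  by apply: leq_trans (ltnW (ltn_expl _ _)); rewrite ?leq_add2r.
by rewrite expn_gt0.
Qed.

(* With [p ^ k] just above [d] for each prime [p], the product of these powers
   exceeds the number [d ^ om] of blocks, while each polynomial has degree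
   [O(d)]. *)
Lemma all_gates_of_bundles h e : all_bundles h e.+1 -> all_gates h (e + om).
Proof.
(* The summands of [K'] pay, in order, for the number of primes, the degree [m * d], the bound
   [(d ^ om).+1 ^ (m * d)] on the number of block sets, and the conjunctions themselves. *)
case=> K HK; pose K' := om + (m.+1 + (om.+1 * m + m.+1 * (K * m))).
exists K' => n d xs d0 okxs sz.
pose k p := (trunc_log p d).+1.
have X1 : 1 < d.+1 by [].
have md0 : 0 < m * d by rewrite muln_gt0 mpos.
have mX c : c <= d.+1 ^ c.
  by apply: leq_trans (leq_exp2r_wk c X1); rewrite ltnW // ltn_expl.
have mdX : m * d < d.+1 ^ m.+1.
  rewrite expnS mulnC; apply: leq_trans (_ : d.+1 * m <= _).
    by rewrite mulSn; lia.
  by rewrite leq_mul2l mX.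
(* [HK] is used at scale [m * d]: as [p ^ k p <= m * d], up to [m * d] blocks of [d ^ e] variables
   are joined. *)
have [||||| g [gE Bg]] := @bundle_all_blocks m n mpos h ((m * d).+1 ^ (K * (m * d)))
  ((m * d) ^ e.+1) (m * d) (d ^ om) (d ^ e) xs k _ _ _ _ _ okxs.
- by move=> p ys pm okys szys; apply: HK.
- apply: (@leq_trans (d.+1 ^ om)); first by rewrite ltn_exp2r // ltnW.
  have : all prime (primes m) by apply/allP => p; rewrite mem_primes => /and3P[].
  rewrite /omega; elim: (primes m) => [|p r IH] /=; first by rewrite big_nil.
  case/andP=> p_pr /IH {}IH; rewrite big_cons expnS leq_mul //.
  by rewrite trunc_log_ltn ?prime_gt1.
- move=> p; rewrite mem_primes => /and3P[p_pr _ pm].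
  by rewrite /k expnS leq_mul ?trunc_logP ?prime_gt1 // dvdn_leq.
- by rewrite expnS leq_mul // leq_exp2r_wk // leq_pmull.
- by rewrite -expnD addnC.
exists g; split=> //; apply: bundle_leq Bg => //.
have -> : K' * d = om * d + (m.+1 * d + (om.+1 * m * d + m.+1 * (K * m) * d)).
  by rewrite /K'; nia.
rewrite (expnD _ (om * d)) (expnD _ (m.+1 * d)) (expnD _ (om.+1 * m * d)).
apply: leq_mul; last apply: leq_mul; last apply: leq_mul.
- by apply: leq_trans (mX om) _; rewrite leq_pexp2l // leq_pmulr.
- by apply: leq_trans (ltnW mdX) _; rewrite leq_pexp2l // leq_pmulr.
- rewrite -mulnA (expnM _ om.+1) leq_exp2r_wk // expnS.
  apply: leq_ltn_trans (leq_exp2r_wk om (leqnSn d)) _.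
  by rewrite ltn_Pmull // expn_gt0.
- by rewrite -!mulnA (expnM _ m.+1) leq_exp2r_wk.
Qed.

(** One more gate turns the divisibility test into a Boolean, which can be weighted by [m %/ p]; the
    increment of [K] pays for it. *)
Lemma all_bundles_of_gates h e : all_gates h e -> all_bundles h.+1 e.
Proof.
case=> K HK; exists K.+1 => n d p xs d0 pm okxs sz.
have [g [gE Bg]] := HK n d xs d0 okxs sz.
apply: (bundle_eqmod (g := fun x => m %/ p * (g x %% m == 0))).
  by move=> x; rewrite -gE.
apply/bundle_scale; apply: bundle_leq (bundle_gate mpos (fun v => v == 0) Bg) => //.
rewrite mulSn addnC expnD; apply: leq_trans (_ : d.+1 ^ (K * d) * 2 <= _).
  by rewrite muln2 -addnn -addn1 leq_add2l expn_gt0.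
by rewrite leq_mul2l; apply/orP; right; apply: leq_trans (leq_pexp2l _ d0).
Qed.

Lemma all_gates_depth h : all_gates h.+1 (h * (om - 1) + om).
Proof.
elim: h => [|h IH]; first exact: (all_gates_of_bundles all_bundles1).
(* Each layer takes exponent [e] to [e - 1 + om]: one factor [d] is spent on joining blocks, and
   [om] are gained from their number. *)
rewrite (_ : _ + _ = ((h * (om - 1) + om).-1 + om)); last first.
  by rewrite mulSn; move: m_omega; set t := h * _; lia.
apply: all_gates_of_bundles; rewrite prednK; last first.
  by rewrite addn_gt0 (ltnW m_omega) orbT.
exact: all_bundles_of_gates.
Qed.

Lemma circuit_AND h : exists K, forall n d, 0 < d -> n <= d ^ (h.+1 * (om - 1) + om) ->
  exists C : circuit m, [/\ CC_circuit h.+3 n C, computes_AND n C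
    & size C <= d.+1 ^ (K * d)].
Proof.
have [K HK] := all_gates_depth h.+1.
(* The added [h.+3] pays for the output gate and the chain of dummy gates. *)
exists (K + h.+3) => n d d0 nd.
have [||g [gE Bg]] := HK n d (iota 0 n) d0; rewrite ?size_iota //.
  by apply/allP => i; rewrite mem_iota.
have [C [CC sz out]] := bundle_circuit mpos (fun v => v == 0) Bg.
exists C; split=> //.
  move=> x; rewrite out -[_ == 0]/(m %| _) gE.
  apply/allP/forallP => H i; first by apply: H; rewrite mem_iota ltn_ord.
  by rewrite mem_iota => ilt; apply: (H (Ordinal ilt)).
apply: leq_trans sz _; rewrite mulnDl expnD.
have E1 : 0 < d.+1 ^ (K * d) by rewrite expn_gt0.
have E2 : h.+3 < d.+1 ^ (h.+3 * d).
  apply: leq_trans (leq_trans (leq_exp2r_wk _ (_ : 2 <= d.+1)) (leq_pexp2l _ (leq_pmulr _ d0))) => //.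
  exact: ltn_expl.
nia.
Qed.

End Growth.

(* Real estimates and the final bound *)
Delimit Scope R_scope with R.

Lemma INR_expn a e : INR (a ^ e) = (INR a ^ e)%R.
Proof. by elim: e => // e IH; rewrite expnS mult_INR IH. Qed.

Lemma INR_leq a b : a <= b -> (INR a <= INR b)%R.
Proof. by move/leP/le_INR. Qed.

Lemma exp_le_compat (x y : R) : (x <= y -> exp x <= exp y)%R.
Proof. by case=> [/exp_increasing/Rlt_le|->]; last exact: Rle_refl. Qed.

Lemma ln_le_compat (x y : R) : (0 < x -> x <= y -> ln x <= ln y)%R.
Proof.
by move=> x0 [/(ln_increasing _ _ x0)/Rlt_le|->]; last exact: Rle_refl.
Qed.

Lemma Rpower_ge1 (x a : R) : (1 <= x -> 0 <= a -> 1 <= Rpower x a)%R.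
Proof.
move=> x1 a0; rewrite -(Rpower_O x); last by lra.
by apply: Rle_Rpower.
Qed.

(** [up] exceeds the root by at most 1, which at most doubles it since the root is at least 1. *)
Lemma ceil_root n e : 0 < n -> 0 < e ->
  exists d, [/\ 0 < d, n <= d ^ e & (INR d <= 2 * Rpower (INR n) (/ INR e))%R].
Proof.
move=> n0 e0; set r := Rpower _ _.
have eR : (0 < INR e)%R by apply: lt_0_INR; apply/ltP.
have nR : (1 <= INR n)%R by apply: (INR_leq n0).
have r1 : (1 <= r)%R.
  by apply: Rpower_ge1 => //; apply: Rlt_le; apply: Rinv_0_lt_compat.
have [up1 up2] := archimed r.
have up0 : (0 <= up r)%Z by apply: le_IZR; lra.
have dE : INR (Z.to_nat (up r)) = IZR (up r) by rewrite INR_IZR_INZ Z2Nat.id.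
exists (Z.to_nat (up r)); split.
- by apply/ltP; apply: INR_lt; rewrite dE /=; lra.
- apply/leP; apply: INR_le; rewrite INR_expn dE.
  apply: Rle_trans (_ : (r ^ e <= _)%R); last by apply: pow_incr; lra.
  rewrite -Rpower_pow; last by lra.
  by rewrite /r Rpower_mult Rinv_l ?Rpower_1; lra.
- by rewrite dE; lra.
Qed.

Theorem theorem1p2 (h m : nat) (Hh : 3 <= h) (Hm : 0 < m) (Homega : 2 <= omega m) :
  exists (c : R) (N : nat), (0 < c)%R /\
    forall n : nat, N <= n ->
      exists C : circuit m,
        CC_circuit h n C /\ computes_AND n C /\
        (INR (circuit_size C) <=
           Rpower 2 (c * Rpower (INR n)
                          (/ INR ((omega m - 1) * (h - 2) + varpi m)) * ln (INR n)))%R.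
Proof.
case: h Hh => [|[|[|h]]] // _.
set E := (_ + varpi m); set e := h.+1 * (omega m - 1) + omega m.
have Ee : E <= e.
  by rewrite /E /e mulnC subSS subSS subn0 leq_add2l; apply: count_size.
have E0 : 0 < E by rewrite addn_gt0 muln_gt0 subn_gt0 Homega.
have [K HK] := circuit_AND Hm Homega h.
(* [Rpower 2] contributes a factor [ln 2 > 1/2], so covering [4 * K] takes [8 * K]; the [+ 1] gives
   positivity. The threshold 3 ensures [2 * n + 1 <= n * n], which bounds [ln (d + 1)] by
   [2 * ln n]. *)
exists (8 * INR K + 1)%R, 3; have K0 := pos_INR K; split; first by lra.
move=> n n3; have [||d [d0 nd dr]] := @ceil_root n e.
- exact: leq_trans n3.
- exact: leq_trans Ee.
have [C [CC CA Cs]] := HK n d d0 nd; exists C; split=> //; split=> //.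
have nR : (3 <= INR n)%R by have := INR_leq n3; rewrite /=; lra.
have ER : (1 <= INR E)%R by apply: (INR_leq E0).
have EeR : (INR E <= INR e)%R by apply: INR_leq.
set r := Rpower _ (/ INR E).
(* As [E <= e] and [n >= 1], the root of order [E] is at least that of order [e]. *)
have {}dr : (INR d <= 2 * r)%R.
  apply: Rle_trans dr _; apply: Rmult_le_compat_l; first by lra.
  by apply: Rle_Rpower; [lra | apply: Rinv_le_contravar; lra].
have rn : (r <= INR n)%R.
  rewrite -[X in (_ <= X)%R]Rpower_1; last by lra.
  apply: Rle_Rpower; first by lra.
  by rewrite -Rinv_1; apply: Rinv_le_contravar; lra.
have d1R : (1 <= INR d)%R by apply: (INR_leq d0).
have ln0 : (0 < ln (INR n))%R by rewrite -ln_1; apply: ln_increasing; lra.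
have lnd : (ln (INR d.+1) <= 2 * ln (INR n))%R.
  have -> : (2 * ln (INR n) = ln (INR n * INR n))%R by rewrite ln_mult; lra.
  by apply: ln_le_compat; rewrite S_INR; nra.
have lnd0 : (0 <= ln (INR d.+1))%R.
  by rewrite -ln_1; apply: ln_le_compat; rewrite ?S_INR; lra.
apply: Rle_trans (INR_leq Cs) _.
rewrite INR_expn -Rpower_pow; last by rewrite S_INR; lra.
rewrite /Rpower; apply: exp_le_compat; rewrite mult_INR.
have ln2 := ln_lt_2.
apply: Rle_trans (_ : (INR K * (2 * r) * (2 * ln (INR n)) <= _)%R).
  apply: Rmult_le_compat => //; first by apply: Rmult_le_pos; lra.
  by apply: Rmult_le_compat_l.
have rl : (0 <= r * ln (INR n))%R by apply: Rmult_le_pos; lra.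
have : (8 * INR K + 1 <= (8 * INR K + 1) * (2 * ln 2))%R by nra.
move: rl; set q := (r * ln (INR n))%R => q0 H.
have -> : (INR K * (2 * r) * (2 * ln (INR n)) = 4 * INR K * q)%R by rewrite /q; ring.
have -> : ((8 * INR K + 1) * r * ln (INR n) * ln 2 = (8 * INR K + 1) * (2 * ln 2) / 2 * q)%R.
  by rewrite /q; field.
by apply: Rmult_le_compat_r => //; lra.
Qed.
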